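(* Let $(X,d,A)$ be a metric pair with $A\neq\varnothing$ such that $(X/A,\overline d_1,[A])$ is uniformly discrete, and let $\psi:[0,\infty)\to[0,\infty)$ satisfy $\psi(0)=0$ and $\sum_{x,y\in X\setminus A,\,x\ne y}\psi(\overline d_1(x,y))<\infty$. For every finite $F\subset X\setminus A$, with $X_F=A\cup F$, and every $\chi\in\widehat{K(X_F,A)}$, $$\lambda^\psi(\chi\circ\pi_F)=\lambda_F^{D,\psi}(\chi).$$
   Context: Metric pair: $(X,d)$ is a metric space and $A\subseteq X$ is nonempty. Put $d(x,A)=\inf_{a\in A}d(x,a)$ and $d_1(x,y)=\min(d(x,y),d(x,A)+d(y,A))$. $X/A$ is the quotient collapsing $A$ to a basepoint $[A]$, and $\overline d_1$ is the metric on $X/A$ induced by $d_1$ (so $\overline d_1(x,y)=d_1(x,y)$ and $\overline d_1(x,[A])=d(x,A)$ for $x,y\in X\setminus A$). Uniformly discrete means: there is $c>0$ with $\overline d_1(u,v)\ge c$ for all distinct $u,v\in X/A$. $D(X,A)$ is the free commutative monoid on $X$ modulo the submonoid generated by $A$; $K(X,A)$ is its Grothendieck group, identified with $\bigoplus_{x\in X\setminus A}\mathbb Z e_x$; similarly $K(X_F,A)\cong\bigoplus_{x\in F}\mathbb Z e_x$. Hats denote groups of characters into $\mathbb T$. $\pi_F:K(X,A)\to K(X_F,A)$ is the coordinate projection: $\pi_F(e_x)=e_x$ for $x\in F$, $\pi_F(e_x)=0$ for $x\in (X\setminus A)\setminus F$. Sums over possibly uncountable index sets of nonnegative terms are suprema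 of finite partial sums. Define $\nu:K(X,A)\setminus\{0\}\to[0,\infty)$ by $\nu(e_x-e_y)=\frac12\psi(\overline d_1(x,y))$ for $x,y\in X\setminus A$, $x\ne y$, and $\nu(\kappa)=0$ for all other $\kappa$; $\lambda^\psi(\theta)=\sum_{\kappa\in K(X,A)\setminus\{0\}}\nu(\kappa)(1-\Re\,\theta(\kappa))$ for $\theta\in\widehat{K(X,A)}$. For $\chi\in\widehat{K(X_F,A)}$, $$\lambda_F^{D,\psi}(\chi)=\frac12\sum_{x,y\in F,\, x\ne y}\psi(\overline d_1(x,y))\bigl(1-\Re\chi(e_x-e_y)\bigr)+\sum_{x\in F}\Bigl(\sum_{y\in(X\setminus A)\setminus F}\psi(\overline d_1(x,y))\Bigr)\bigl(1-\Re\chi(e_x)\bigr).$$ *)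

(* Defs.v *)
From HB Require Import structures.
From mathcomp Require Import all_boot all_order all_algebra.
From mathcomp Require Import generic_quotient complex freeg.
From mathcomp Require Import all_classical all_reals all_analysis.

Set Implicit Arguments.
Unset Strict Implicit.
Unset Printing Implicit Defensive.

Import Order.TTheory GRing.Theory Num.Theory.

Local Open Scope classical_set_scope.
Local Open Scope ring_scope.
Local Open Scope quotient_scope.

Section MetricPair.
Context {R : realType} {X : metricType R}.
Implicit Types (A : set X) (x y : X).

Definition setdist A x : R := inf [set mdist x a | a in A].

Definition d1 A x y : R :=
  Num.min (mdist x y) (setdist A x + setdist A y).

Definition collapse_rel A : rel X :=
  [rel x y | (x == y) || ((x \in A) && (y \in A))].

Lemma collapse_refl A : reflexive (collapse_rel A).
Proof. by move=> x; apply/orP; left. Qed.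

Lemma collapse_sym A : symmetric (collapse_rel A).
Proof. by move=> x y; rewrite /collapse_rel/= eq_sym andbC. Qed.

Lemma collapse_trans A : transitive (collapse_rel A).
Proof.
move=> y x z /orP[/eqP->//|/andP[xA yA]] /orP[/eqP<-|/andP[_ zA]].
  by apply/orP; right; apply/andP.
by apply/orP; right; apply/andP.
Qed.

Definition collapse_equiv A :=
  EquivRel _ (collapse_refl A) (@collapse_sym A) (@collapse_trans A).

(* X/A; its basepoint is \pi a for any a in A. *)
Definition collapse A := {eq_quot collapse_equiv A}.


(* d1 is constant on classes, so the representatives do not matter: see
   dbar1_pi and dbar1_base below. *)
Definition dbar1 A (u v : collapse A) : R := d1 A (repr u) (repr v).

Lemma setdist_lb A x : has_lbound [set mdist x a | a in A].
Proof. by exists 0 => _ [a _ <-]; exact: mdist_ge0. Qed.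

Lemma setdist_ge0 A x : 0 <= setdist A x.
Proof.
have [->|/set0P A0] := eqVneq A set0; first by rewrite /setdist image_set0 inf0.
by apply: lb_le_inf; [exact: image_nonempty|move=> _ [a _ <-]; exact: mdist_ge0].
Qed.

Lemma setdist_le A x a : A a -> setdist A x <= mdist x a.
Proof. by move=> Aa; apply: ge_inf; [exact: setdist_lb|exists a]. Qed.

Lemma setdist_in A a : A a -> setdist A a = 0.
Proof.
move=> Aa; apply/eqP; rewrite eq_le setdist_ge0 andbT.
by rewrite -(mdistxx a) setdist_le.
Qed.

Lemma d1C A x y : d1 A x y = d1 A y x.
Proof. by rewrite /d1 metric_sym addrC. Qed.

Lemma d1_base A x a : A a -> d1 A x a = setdist A x.
Proof.
by move=> Aa; rewrite /d1 (setdist_in Aa) addr0; apply/min_idPr/setdist_le.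
Qed.

Lemma d1_collapse A x x' y : collapse_rel A x x' -> d1 A x y = d1 A x' y.
Proof.
move=> /orP[/eqP->//|/andP[]]; rewrite !inE => xA x'A.
by rewrite !(d1C _ _ y) !d1_base.
Qed.

Lemma dbar1_pi A x y : dbar1 (\pi_(collapse A) x) (\pi_(collapse A) y) = d1 A x y.
Proof.
have reprE z : collapse_rel A (repr (\pi_(collapse A) z)) z.
  by have /eqmodP := reprK (\pi_(collapse A) z).
by rewrite /dbar1 (d1_collapse _ (reprE x)) d1C (d1_collapse _ (reprE y)) d1C.
Qed.

Lemma dbar1_base A x a :
  A a -> dbar1 (\pi_(collapse A) x) (\pi_(collapse A) a) = setdist A x.
Proof. by move=> Aa; rewrite dbar1_pi d1_base. Qed.

Definition uniformly_discrete A : Prop :=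
  exists2 c : R, 0 < c & forall u v : collapse A, u <> v -> c <= dbar1 u v.

Definition offdiag (S : set X) : set (X * X) :=
  [set p | [/\ S p.1, S p.2 & p.1 <> p.2]].

Definition wt A (psi : R -> R) x y : R :=
  psi (dbar1 (\pi_(collapse A) x) (\pi_(collapse A) y)).

End MetricPair.

Section VirtualDiagrams.
Context {R : realType} {X : metricType R}.
Implicit Types (Y A F : set X) (x y : X).

(* The Grothendieck group of the free commutative monoid on Y modulo the
   submonoid generated by A, for A `<=` Y: the direct sum of copies of Z over
   Y `\` A.  Kext_unique below is the universal property that justifies the
   identification. *)
Definition K Y A := {freeg (Y `\` A) / int}.

(* The class of the point x of Y; it is 0 for x in A (and, as a junk value, for
   x outside Y). *)
Definition e Y A x : K Y A :=
  oapp (fun p : Y `\` A => << p >> : K Y A) 0 (insub x).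

Lemma e_base Y A a : A a -> e Y A a = 0.
Proof.
by move=> Aa; rewrite /e; case: insubP => //= u; rewrite inE => -[_ /(_ Aa)].
Qed.

Lemma e_val Y A (p : Y `\` A) : e Y A (val p) = << p >>.
Proof. by rewrite /e valK. Qed.

Lemma Kext_unique Y A (G : zmodType) (f : X -> G) :
    (forall a, A a -> f a = 0) ->
  (exists2 g : K Y A -> G, {morph g : k l / k + l} &
    forall x, Y x -> g (e Y A x) = f x) /\
  (forall g g' : K Y A -> G, {morph g : k l / k + l} ->
    {morph g' : k l / k + l} ->
    (forall x, Y x -> g (e Y A x) = g' (e Y A x)) -> g = g').
Proof.
move=> fA; split.
  exists (fun k => \sum_(p <- dom k) f (val p) *~ coeff p k).
    have coeff_sum (s : seq (Y `\` A)) (k : K Y A) :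
        uniq s -> {subset dom k <= s} ->
        \sum_(p <- s) f (val p) *~ coeff p k =
        \sum_(p <- dom k) f (val p) *~ coeff p k.
      move=> us ks; rewrite (bigID (mem (dom k)))/= [X in _ + X]big1 ?addr0; last first.
        move=> p pk; have -> : coeff p k = 0 by apply: coeff_outdom.
        by rewrite mulr0z.
      rewrite -big_filter; apply: perm_big; apply: uniq_perm.
      - exact: filter_uniq.
      - exact: uniq_dom.
      - by move=> p; rewrite mem_filter; case: (boolP (p \in dom k)) => // /ks.
    move=> k l; pose s := undup (dom k ++ dom l).
    rewrite -(coeff_sum s (k + l)) ?undup_uniq//; last first.
      by move=> p /domD_subset; rewrite mem_undup.
    rewrite -(coeff_sum s k) ?undup_uniq//; last first.
      by move=> p pk; rewrite mem_undup mem_cat pk.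
    rewrite -(coeff_sum s l) ?undup_uniq//; last first.
      by move=> p pk; rewrite mem_undup mem_cat pk orbT.
    by rewrite -big_split; apply: eq_bigr => p _; rewrite coeffD mulrzDr.
  move=> x Yx; have [Ax|Ax] := pselect (A x).
    by rewrite (e_base _ Ax) dom0 big_nil fA.
  have px : x \in Y `\` A by rewrite inE.
  rewrite -[x]/(val (exist _ x px : Y `\` A)) e_val domU1 big_seq1.
  by rewrite coeffU eqxx mulr1 mulr1z.
move=> g g' gD g'D gg'; apply/funext => k.
have g0 (h : K Y A -> G) : {morph h : k l / k + l} -> h 0 = 0.
  by move=> hD; apply: (addrI (h 0)); rewrite -hD !addr0.
have gN (h : K Y A -> G) : {morph h : k l / k + l} -> {morph h : k / - k}.
  by move=> hD l; apply: (addrI (h l)); rewrite -hD !subrr g0.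
have gM (h : K Y A -> G) : {morph h : k l / k + l} ->
    forall l n, h (l *~ n) = h l *~ n.
  move=> hD l n; have hMn m : h (l *+ m) = h l *+ m.
    by elim: m => [|m IH]; rewrite ?mulr0n ?g0// !mulrS hD IH.
  by case: n => n; rewrite ?NegzE ?mulrNz ?(gN _ hD) -!pmulrn hMn.
rewrite -(freeg_sumE k); elim: (dom k) => [|p s IH].
  by rewrite big_nil !g0.
rewrite big_cons gD g'D IH; congr (_ + _).
have -> : << coeff p k *g p >> = << p >> *~ coeff p k :> K Y A.
  by rewrite freegU_mulz intz.
rewrite !gM// -e_val gg'//.
by have /set_mem[] := valP p.
Qed.

Definition piF A F (k : K setT A) : K (A `|` F) A :=
  fglift (fun p : setT `\` A =>
    if val p \in F then e (A `|` F) A (val p) else 0) k.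

Lemma piF_additive A F : {morph @piF A F : k l / k + l}.
Proof.
have hB : {morph @piF A F : k l / k - l} by exact: lift_is_additive.
have h0 : @piF A F 0 = 0 by rewrite -[in LHS](subrr 0) hB subrr.
have hN l : piF F (- l) = - @piF A F l by rewrite -[in LHS]sub0r hB h0 sub0r.
by move=> k l; rewrite -{1}[l]opprK hB hN opprK.
Qed.

Lemma piF_e A F x : ~ A x ->
  piF F (e setT A x) = if x \in F then e (A `|` F) A x else 0.
Proof.
move=> Ax; have px : x \in [set: X] `\` A by rewrite inE.
rewrite -[x]/(val (exist _ x px : setT `\` A)) e_val /piF.
by rewrite liftU scale1r.
Qed.

(* G is discrete, so characters need no continuity condition. *)
Definition dual (G : zmodType) : set (G -> R[i]) :=
  [set chi | (forall k, `|chi k| = 1) /\ {morph chi : k l / k + l >-> k * l}].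

Lemma dual_piF A F (chi : K (A `|` F) A -> R[i]) :
  dual chi -> dual (chi \o @piF A F).
Proof.
move=> [chi1 chiD]; split=> [k|k l] /=; first exact: chi1.
by rewrite piF_additive chiD.
Qed.

(* By nu_e below, the pair x, y is determined by e x - e y. *)
Definition nu A (psi : R -> R) (k : K setT A) : R :=
  match pselect (exists p, offdiag (~` A) p /\
                   k = e setT A p.1 - e setT A p.2) with
  | left h => let p := projT1 (cid h) in 2^-1 * wt A psi p.1 p.2
  | right _ => 0
  end.

Lemma e_sub_inj A p q : offdiag (~` A) p -> offdiag (~` A) q ->
  e setT A p.1 - e setT A p.2 = e setT A q.1 - e setT A q.2 -> p = q.
Proof.
case: p q => [x y] [z t] [/= Ax Ay xy] [/= Az At zt].
have coeff_e u v : ~ A u -> forall pv : v \in [set: X] `\` A,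
    coeff (exist _ v pv : setT `\` A) (e setT A u) = (u == v)%:R.
  move=> Au pv; have pu : u \in [set: X] `\` A by rewrite inE.
  by rewrite -[u]/(val (exist _ u pu : setT `\` A)) e_val coeffU mul1r.
have inD u : ~ A u -> u \in [set: X] `\` A by move=> ?; rewrite inE.
move=> E.
have := congr1 (coeff (exist _ x (inD x Ax) : setT `\` A)) E.
have := congr1 (coeff (exist _ y (inD y Ay) : setT `\` A)) E.
rewrite !coeffB !coeff_e// !eqxx (eq_sym y x).
have /eqP/negbTE -> := xy => Ey Ex.
have -> : x = z.
  by move: Ex; case: (eqVneq z x) => [->//|_]; case: (t == x).
have -> // : y = t.
by move: Ey; case: (eqVneq t y) => [->//|_]; case: (z == y).
Qed.

Lemma nu_e A psi x y : ~ A x -> ~ A y -> x <> y ->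
  nu psi (e setT A x - e setT A y) = 2^-1 * wt A psi x y.
Proof.
move=> Ax Ay xy; rewrite /nu; case: pselect => [h|[]]; last by exists (x, y).
case: (cid h) => /= p [pD pE].
by have <- : (x, y) = p by exact: (@e_sub_inj A (x, y) p _ pD pE).
Qed.

Lemma nu_other A psi (k : K setT A) :
    (forall x y, ~ A x -> ~ A y -> x <> y -> k <> e setT A x - e setT A y) ->
  nu psi k = 0.
Proof.
move=> kN; rewrite /nu; case: pselect => // h; case: (h) => -[x y] [[Ax Ay xy] kE].
by case: (kN x y Ax Ay xy kE).
Qed.

(* lambda and lambdaF are extended reals because they contain sums over
   arbitrary index sets, which esum takes as suprema of finite partial sums. *)
Definition lambda A psi (theta : K setT A -> R[i]) : \bar R :=
  \esum_(k in [set k | k <> 0]) (nu psi k * (1 - complex.Re (theta k)))%:E.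

Definition lambdaF A F psi (chi : K (A `|` F) A -> R[i]) : \bar R :=
  let eF := e (A `|` F) A in
  ((2^-1 * \sum_(p \in offdiag F)
      wt A psi p.1 p.2 * (1 - complex.Re (chi (eF p.1 - eF p.2))))%:E
   + \sum_(x \in F)
      (\esum_(y in ~` A `\` F) (wt A psi x y)%:E)
        * (1 - complex.Re (chi (eF x)))%:E)%E.

End VirtualDiagrams.

(* Main.v *)
Require Import Defs.
From HB Require Import structures.
From mathcomp Require Import all_boot all_order all_algebra.
From mathcomp Require Import generic_quotient complex freeg.
From mathcomp Require Import all_classical all_reals all_analysis.
From mathcomp Require Import ring.

Set Implicit Arguments.
Unset Strict Implicit.
Unset Printing Implicit Defensive.

Import Order.TTheory GRing.Theory Num.Theory.

Local Open Scope classical_set_scope.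
Local Open Scope ring_scope.

(** Reindexing the support of [nu] by ordered pairs [(x, y)], the sum
    [lambda psi (chi \o piF F)] runs over the off-diagonal pairs of the
    complement of [A], and [piF F] replaces [e x] by [0] when [x] is outside
    [F].  Pairs inside [F] give the first sum of [lambdaF]; pairs with both
    points outside [F] contribute [0]; and since [Re (chi (- k)) = Re (chi k)],
    the two kinds of mixed pairs contribute equally, which absorbs the factor
    [1/2] and gives the second sum. *)

(** Scaling acts on each finite partial sum, and a nonnegative real factor commutes with a supremum
    over a nonempty set. *)
Lemma ge0_esumZl (R : realType) (T : choiceType) (I : set T) (a : T -> \bar R)
    (c : R) : 0 <= c -> (forall i, I i -> (0 <= a i)%E) ->
  (\esum_(i in I) (c%:E * a i) = c%:E * \esum_(i in I) a i)%E.
Proof.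
move=> c0 a0; rewrite /esum -ereal_supZl//; last first.
  (* The empty partial sum is a member. Nonemptiness matters for [c = 0]: scaling the supremum [-oo]
     of the empty set by [0] would give [0]. *)
  apply/set0P; exists (\sum_(i \in set0) a i)%E; exists set0 => //.
  exact: fsets_set0.
have fsumZ X : fsets I X ->
    (\sum_(i \in X) (c%:E * a i) = c%:E * \sum_(i \in X) a i)%E.
  move=> [finX XI]; rewrite !fsbig_finite//= big_seq [X in (_ * X)%E]big_seq.
  by rewrite ge0_sume_distrr// => i; rewrite in_fset_set// inE => /XI/a0.
congr ereal_sup; apply/seteqP; split=> [_ [X IX <-]|_ [_ [X IX <-] <-]].
  by exists (\sum_(i \in X) a i)%E; [exists X|rewrite fsumZ].
by exists X; rewrite ?fsumZ.
Qed.

Section Characters.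
Context {R : realType} {G : zmodType} {chi : G -> R[i]}.
Hypothesis chiG : dual chi.

Lemma dual0 : chi 0 = 1.
Proof.
case: chiG => chi1 chiD; apply: (@mulfI _ (chi 0)).
  by rewrite -normr_eq0 chi1 oner_eq0.
by rewrite -chiD addr0 mulr1.
Qed.

Lemma dual_sqr_norm k :
  complex.Re (chi k) ^+ 2 + complex.Im (chi k) ^+ 2 = 1.
Proof.
by case: chiG => chi1 _; apply: complexI; rewrite add_Re2_Im2 chi1 expr1n.
Qed.

(** This makes the terms [1 - Re (chi k)] nonnegative, so that the sums below can be split and
    iterated. *)
Lemma dual_Re_le1 k : complex.Re (chi k) <= 1.
Proof.
apply: le_trans (ler_norm _) _.
rewrite -(@expr_le1 _ 2)// real_normK ?num_real// -(dual_sqr_norm k).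
by rewrite lerDl sqr_ge0.
Qed.

(** [chi (- k)] is the inverse of [chi k], hence its conjugate, as the modulus is 1. *)
Lemma dual_ReN k : complex.Re (chi (- k)) = complex.Re (chi k).
Proof.
case: (chiG) => _ chiD.
have := chiD k (- k); have := dual_sqr_norm k; rewrite subrr dual0.
case: (chi k) (chi (- k)) => [a b] [c d] /= ab1 [Re1 Im0].
(* With [Re1 : 1 = a c - b d] and [Im0 : 0 = a d + b c], both sides become [c (a^2 + b^2)]: on the
   right, [a (a c - b d) + b (a d + b c)]. *)
rewrite -[c]mulr1 -ab1 -[a in RHS]mulr1 Re1.
by rewrite -[RHS]addr0 -(mulr0 b) Im0; ring.
Qed.

End Characters.

Section Weights.
Context {R : realType} {X : metricType R}.
Implicit Types (A F : set X) (psi : R -> R).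

Lemma d1_ge0 A x y : 0 <= d1 A x y.
Proof. by rewrite /d1 le_min mdist_ge0 addr_ge0// setdist_ge0. Qed.

Lemma wtC A psi x y : wt A psi x y = wt A psi y x.
Proof. by rewrite /wt !dbar1_pi d1C. Qed.

Lemma wt_ge0 A psi x y : (forall t, 0 <= t -> 0 <= psi t) -> 0 <= wt A psi x y.
Proof. by move=> psi_ge0; rewrite /wt dbar1_pi psi_ge0 ?d1_ge0. Qed.

Lemma piF_B A F (k l : K setT A) : piF F (k - l) = piF F k - piF F l.
Proof. exact: lift_is_additive. Qed.

(** [nu] vanishes off the set [D] of differences, [D] avoids 0, and by [e_sub_inj] each difference
    comes from a single ordered pair. *)
Lemma lambda_offdiag A psi (theta : K setT A -> R[i]) :
  lambda psi theta =
  \esum_(p in offdiag (~` A)) (2^-1 * wt A psi p.1 p.2 *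
    (1 - complex.Re (theta (e setT A p.1 - e setT A p.2))))%:E.
Proof.
pose D := [set e setT A p.1 - e setT A p.2 | p in offdiag (~` A)].
have e_inj : set_inj (offdiag (~` A))
    (fun p : X * X => e setT A p.1 - e setT A p.2).
  by move=> p q /set_mem pD /set_mem qD; exact: e_sub_inj.
transitivity (\esum_(k in D) (nu psi k * (1 - complex.Re (theta k)))%:E).
  rewrite /lambda esum_mkcond [RHS]esum_mkcond; apply: eq_esum => k _.
  have [[[x y] [/= Ax Ay xy] kE]|kD] := pselect (D k).
    rewrite !mem_set//; first by exists (x, y).
    (* [0 = - 0] would be the image of both [(x, y)] and [(y, x)]. *)
    move=> k0; apply: (xy); suff: (x, y) = (y, x) by case.
    apply: (@e_sub_inj _ _ A) => /=; first by split.
      by split=> //= /esym.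
    by rewrite -[RHS]opprB kE k0 oppr0.
  rewrite (memNset kD) nu_other ?mul0r ?if_same//.
  by move=> x y Ax Ay xy kE; apply: kD; exists (x, y).
rewrite esum_image//; apply: eq_esum => -[x y] [/= Ax Ay xy].
by rewrite nu_e.
Qed.

End Weights.

Theorem lemma7 (R : realType) (X : metricType R) (A : set X) (psi : R -> R)
    (A0 : A !=set0) (XAdisc : uniformly_discrete A)
    (psi_ge0 : forall t : R, 0 <= t -> 0 <= psi t) (psi0 : psi 0 = 0)
    (psi_sum : (\esum_(p in offdiag (~` A)) (wt A psi p.1 p.2)%:E < +oo)%E)
    (F : set X) (Ffin : finite_set F) (FA : F `<=` ~` A)
    (chi : K (A `|` F) A -> R[i]) (chiK : dual chi) :
  lambda psi (chi \o @piF R X A F) = lambdaF psi chi.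
Proof.
have wt0 x y : 0 <= wt A psi x y by exact: wt_ge0.
have cRe k : 0 <= 1 - complex.Re (chi k) by rewrite subr_ge0 dual_Re_le1.
(* For [x] outside [A], [rho x] is the image of [e x] under [piF F]. *)
pose rho x := if x \in F then e (A `|` F) A x else 0.
have rho_in x : F x -> rho x = e (A `|` F) A x by move=> ?; rewrite /rho mem_set.
have rho_out x : ~ F x -> rho x = 0 by move=> ?; rewrite /rho memNset.
pose H (p : X * X) : \bar R :=
  (2^-1 * wt A psi p.1 p.2 * (1 - complex.Re (chi (rho p.1 - rho p.2))))%:E.
have H0 p : (0 <= H p)%E by rewrite lee_fin !mulr_ge0// invr_ge0.
have HC x y : H (x, y) = H (y, x).
  by rewrite /H/= wtC -(opprB (rho y)) (dual_ReN chiK).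
rewrite lambda_offdiag (eq_esum (b := H)); last first.
  by move=> [x y] [/= Ax Ay _]; rewrite /H/= piF_B !piF_e.
(* Four blocks result, in this order: both points in [F], only the first, only the second,
   neither. *)
rewrite (esumID [set p | F p.1])//.
rewrite (esumID [set p | F p.2] (_ `&` [set p | F p.1]))//.
rewrite (esumID [set p | F p.2] (_ `&` ~` [set p | F p.1]))//.
rewrite [X in (_ + (_ + X))%E]esum1 ?adde0; last first.
  move=> [x y] [[_ /= Fx] /= Fy].
  by rewrite /H/= !rho_out// subr0 (dual0 chiK) subrr mulr0.
rewrite -addeA /lambdaF; congr (_ + _)%E.
  rewrite (_ : _ `&` _ `&` _ = offdiag F); last first.
    apply/seteqP; split=> -[x y]; first by move=> [[[]]].
    by move=> [/= Fx Fy xy]; do !split => //=; exact: FA.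
  have finFF : finite_set (offdiag F).
    apply: (sub_finite_set _ (finite_setX Ffin Ffin)).
    by move=> -[x y] [].
  rewrite esum_fset// fsumEFin// mulr_fsumr; congr (_%:E).
  apply: eq_fsbigr => -[x y] /set_mem[/= Fx Fy _].
  by rewrite !rho_in// mulrA.
(* The block with only the first point in [F], written as a dependent product so that [esum_esum]
   applies to it. *)
pose T := F `*`` (fun=> ~` A `\` F).
rewrite (_ : _ `&` _ `&` _ = T); last first.
  apply/seteqP; split=> -[x y]; first by move=> [[[]]].
  move=> [/= Fx [Ay Fy]]; do !split => //=; first exact: FA.
  by move=> xy; apply: Fy; rewrite -xy.
(* Swapping coordinates maps [T] onto the other mixed block, and [HC] says that [H] is invariant. *)
rewrite [X in (_ + X)%E](_ : _ = \esum_(p in T) H p)%E; last first.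
  rewrite (reindex_esum T _ (fun p => (p.2, p.1))); last first.
    split=> [[x y] [/= Fx [Ay Fy]]|[x y] [z t] _ _ [-> ->]//|[x y]].
      do !split => //=; first exact: FA.
      by move=> xy; apply: Fy; rewrite xy.
    by move=> [[[/= Ax Ay xy] Fx] Fy]; exists (y, x).
  by apply: eq_esum => -[x y] _; exact: HC.
rewrite -esumD//.
(* On [T], [a x y] is [H + H], the two halves adding up to 1; its first factor does not depend on
   [y] and leaves the inner sum at the end. *)
pose a x y : \bar R :=
  ((1 - complex.Re (chi (e (A `|` F) A x)))%:E * (wt A psi x y)%:E)%E.
have a0 x y : (0 <= a x y)%E by rewrite mule_ge0 ?lee_fin.
rewrite (eq_esum (b := fun p => a p.1 p.2)); last first.
  move=> [x y] [/= Fx [Ay Fy]].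
  rewrite /H/a/= rho_in// rho_out// subr0 -EFinD -EFinM; congr (_%:E).
  by field.
rewrite -esum_esum// esum_fset//; last by move=> x _; exact: esum_ge0.
apply: eq_fsbigr => x _.
by rewrite [RHS]muleC ge0_esumZl// => y _; rewrite lee_fin.
Qed.
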